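(* Let $R$ be a commutative unital coherent ring and let $S \subseteq R$ be a multiplicatively closed subset. If the localization problem for $R$ at $S$ can be solved algorithmically, then the localization $S^{-1}R$ is a computable ring.
   Context: All rings are commutative and unital. Phrases such as ''can find'', ''can decide'', ''can construct'' are understood algorithmically (constructively), and existential quantifiers are to be realized by algorithms. A subset $S \subseteq R$ is multiplicatively closed if $1 \in S$ and $r,s \in S$ implies $rs \in S$. Matrices act on row vectors from the right. $\mathbb{N}_0$ denotes the non-negative integers. A ring $R$ is called coherent if it is equipped with an algorithm solving the syzygy problem: given $m,n \in \mathbb{N}_0$ and a matrix $A \in R^{m \times n}$, one can find $o \in \mathbb{N}_0$ and a matrix $L \in R^{o \times m}$ such that $LA = 0$ and such that for every $p \in \mathbb{N}_0$ and every $T \in R^{p \times m}$ with $TA = 0$ there exists $U \in R^{p \times o}$ with $UL = T$ (the existence of $U$ also being realized algorithmically). A coherent ring $R$ is called computable if it is additionally equipped with an algorithm solving the lifting problem: given matrices $A \in R^{m \times n}$ and $B \in R^{q \times n}$, one can decide whether there exists $X \in R^{q \times m}$ such that $XA = B$, and in the affirmative case construct such an $X$. The localization problem for $R$ at $S$ is the following: given $\ell \in \mathbb{N}_0$ and a finitely generated ideal $I = \langle f_1, \dots, f_\ell \rangle_R \subseteq R$ (given by its generators), decide whether there exists an element in $I \cap S$, and in the affirmative case construct $a_1, \dots, a_\ell \in R$ such that $\sum_{i=1}^{\ell} a_i f_i \in I \cap S$. *)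

(* Defs.v *)
From Stdlib Require Import Setoid Morphisms Ring_theory Ring.
From mathcomp Require Import all_boot all_algebra.

Set Implicit Arguments.
Unset Strict Implicit.
Unset Printing Implicit Defensive.

(** "Can find", "can decide" and "can construct" are rendered by inhabitants of
    types in [Type] ([sig], [sumor], records of data), so that an algorithm is
    a function of type theory; purely logical side conditions stay in [Prop].

    Rings are setoids.  MathComp's ring structures come with a decidable
    Leibniz equality and a choice operator.  A coherent ring is not assumed to
    have these, decidability of equality is part of what makes a ring
    computable (lift along a matrix with no rows), and the quotient defining
    a localization could not be formed from the given data alone. *)

Record comRing : Type := ComRing {
  car :> Type;
  req : car -> car -> Prop;
  r0 : car;
  r1 : car;
  radd : car -> car -> car;
  rmul : car -> car -> car;
  ropp : car -> car;
  req_equiv : Equivalence req;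
  req_ext : ring_eq_ext radd rmul ropp req;
  rth : ring_theory r0 r1 radd rmul (fun x y => radd x (ropp y)) ropp req
}.

Arguments req {_} _ _.
Arguments r0 {_}.
Arguments r1 {_}.
Arguments radd {_} _ _.
Arguments rmul {_} _ _.
Arguments ropp {_} _.

Declare Scope sring_scope.
Delimit Scope sring_scope with SR.
Notation "x ≡ y" := (req x y) (at level 70, no associativity) : sring_scope.
Notation "0" := r0 : sring_scope.
Notation "1" := r1 : sring_scope.
Notation "x + y" := (radd x y) : sring_scope.
Notation "x * y" := (rmul x y) : sring_scope.
Notation "- x" := (ropp x) : sring_scope.
Notation "\sum_ ( i < n ) F" := (\big[radd/r0]_(i < n) F) : sring_scope.

Local Open Scope sring_scope.

(** ** Matrices: MathComp's container type, with setoid equality and product *)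

Section Matrices.
Variable R : comRing.

Definition eqmat m n (A B : 'M[R]_(m, n)) : Prop :=
  forall i j, A i j ≡ B i j.

Definition mulmat m n p (A : 'M[R]_(m, n)) (B : 'M[R]_(n, p)) : 'M[R]_(m, p) :=
  \matrix_(i, k) \sum_(j < n) (A i j * B j k).

Definition zeromat m n : 'M[R]_(m, n) := const_mx 0.

End Matrices.

Arguments zeromat {R m n}.

(** ** Coherent and computable rings *)

(** The operations below act on representatives and are not required to
    respect the setoid equality: only their specifications matter. *)

Record syzygies (R : comRing) m n (A : 'M[R]_(m, n)) : Type := Syzygies {
  syz_rows : nat;
  syz_mat : 'M[R]_(syz_rows, m);
  syz_zero : eqmat (mulmat syz_mat A) zeromat;
  syz_factor : forall p (T : 'M[R]_(p, m)), eqmat (mulmat T A) zeromat ->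
    {U : 'M[R]_(p, syz_rows) | eqmat (mulmat U syz_mat) T}
}.

Definition coherent (R : comRing) : Type :=
  forall m n (A : 'M[R]_(m, n)), syzygies A.

Definition lifting_solver (R : comRing) : Type :=
  forall m n q (A : 'M[R]_(m, n)) (B : 'M[R]_(q, n)),
    {X : 'M[R]_(q, m) | eqmat (mulmat X A) B}
    + {~ exists X : 'M[R]_(q, m), eqmat (mulmat X A) B}.

Record computable (R : comRing) : Type := Computable {
  computable_coherent : coherent R;
  computable_lifting : lifting_solver R
}.

(** ** Multiplicatively closed subsets and the localization problem *)

Record multClosed (R : comRing) : Type := MultClosed {
  mc_mem :> R -> Prop;
  mc_ext : Proper (@req R ==> iff) mc_mem;
  mc_one : mc_mem 1;
  mc_mul : forall r s, mc_mem r -> mc_mem s -> mc_mem (r * s)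
}.

Definition in_ideal (R : comRing) l (f : 'I_l -> R) (x : R) : Prop :=
  exists a : 'I_l -> R, x ≡ \sum_(i < l) (a i * f i).

Definition localization_solver (R : comRing) (S : multClosed R) : Type :=
  forall l (f : 'I_l -> R),
    {a : 'I_l -> R | let x := \sum_(i < l) (a i * f i) in in_ideal f x /\ S x}
    + {~ exists x : R, in_ideal f x /\ S x}.

(** ** The localization *)

Section Localization.
Variables (R : comRing) (S : multClosed R).

Record frac : Type := Frac { num : R; den : R; den_mem : S den }.

(** The factor [u] is needed because [S] may contain zero divisors. *)
Definition frac_eq (x y : frac) : Prop :=
  exists2 u : R, S u & u * (num x * den y) ≡ u * (num y * den x).

Definition frac0 : frac := Frac 0 (mc_one S).
Definition frac1 : frac := Frac 1 (mc_one S).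
Definition frac_add (x y : frac) : frac :=
  Frac (num x * den y + num y * den x) (mc_mul (den_mem x) (den_mem y)).
Definition frac_mul (x y : frac) : frac :=
  Frac (num x * num y) (mc_mul (den_mem x) (den_mem y)).
Definition frac_opp (x : frac) : frac := Frac (- num x) (den_mem x).

#[local] Instance req_equiv_inst : Equivalence (@req R) := req_equiv R.
#[local] Instance radd_proper : Proper (req ==> req ==> req) (@radd R) :=
  Radd_ext (req_ext R).
#[local] Instance rmul_proper : Proper (req ==> req ==> req) (@rmul R) :=
  Rmul_ext (req_ext R).
#[local] Instance ropp_proper : Proper (req ==> req) (@ropp R) :=
  Ropp_ext (req_ext R).

Add Ring carrier_ring : (rth R) (setoid (req_equiv R) (req_ext R)).

Lemma frac_eq_of (x y : frac) : num x * den y ≡ num y * den x -> frac_eq x y.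
Proof.
intros H; exists 1; [exact (mc_one S) | rewrite H; reflexivity].
Qed.

Lemma frac_eq_equiv : Equivalence frac_eq.
Proof.
split.
- intros x; apply frac_eq_of; reflexivity.
- intros x y [u Su H]; exists u; [exact Su | symmetry; exact H].
- intros [a s Ss] [b t St] [c v Sv] [u Su H] [w Sw K]; simpl in *.
  exists (u * w * t); [repeat apply mc_mul; assumption | simpl].
  transitivity (w * v * (u * (a * t))); [ring |].
  rewrite H.
  transitivity (u * s * (w * (b * v))); [ring |].
  rewrite K; ring.
Qed.

Lemma frac_eq_ext : ring_eq_ext frac_add frac_mul frac_opp frac_eq.
Proof.
split.
- intros [a s Ss] [b t St] [u Su H] [a' s' Ss'] [b' t' St'] [w Sw K].
  simpl in *; exists (u * w); [apply mc_mul; assumption | simpl].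
  transitivity (w * s' * t' * (u * (a * t)) + u * s * t * (w * (a' * t')));
    [ring |].
  rewrite H K; ring.
- intros [a s Ss] [b t St] [u Su H] [a' s' Ss'] [b' t' St'] [w Sw K].
  simpl in *; exists (u * w); [apply mc_mul; assumption | simpl].
  transitivity ((u * (a * t)) * (w * (a' * t'))); [ring |].
  rewrite H K; ring.
- intros [a s Ss] [b t St] [u Su H]; simpl in *; exists u; [exact Su | simpl].
  transitivity (- (u * (a * t))); [ring |].
  rewrite H; ring.
Qed.

Lemma frac_rth : ring_theory frac0 frac1 frac_add frac_mul
  (fun x y => frac_add x (frac_opp y)) frac_opp frac_eq.
Proof. split; intros; apply frac_eq_of; simpl; ring. Qed.

Definition localization : comRing :=
  ComRing frac_eq_equiv frac_eq_ext frac_rth.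

End Localization.

(* Main.v *)
(** Write [Q] for the localization.  Over [Q] denominators can be cleared, so
    syzygies of a matrix over [Q] are the images of the syzygies over [R] of its
    numerators.  For the lifting problem, [x A = b] has a solution over [Q] if
    and only if [S] meets the ideal of those [r] with [r b] in the row space of
    [A] over [R]; this ideal is generated by the first column of the syzygies
    of [A] with the row [b] put on top.  Equality in [Q] only says that some
    [u] in [S] annihilates a difference [x]; such a [u] is recovered from
    the localization problem for the annihilator of [x], which coherence
    makes finitely generated. *)
From Stdlib Require Import Setoid Morphisms Ring_theory Ring.
From mathcomp Require Import all_boot all_algebra.
Require Import Defs.

Set Implicit Arguments.
Unset Strict Implicit.
Unset Printing Implicit Defensive.

Local Open Scope sring_scope.

#[local] Instance req_equivalence (R : comRing) : Equivalence (@req R) :=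
  req_equiv R.
#[local] Instance radd_proper (R : comRing) :
  Proper (req ==> req ==> req) (@radd R) := Radd_ext (req_ext R).
#[local] Instance rmul_proper (R : comRing) :
  Proper (req ==> req ==> req) (@rmul R) := Rmul_ext (req_ext R).
#[local] Instance ropp_proper (R : comRing) : Proper (req ==> req) (@ropp R) :=
  Ropp_ext (req_ext R).

(** * Finite sums and matrix algebra over a setoid ring *)

Section SetoidMatrices.
Variable R : comRing.
Add Ring sring : (rth R) (setoid (req_equiv R) (req_ext R)).

Lemma sum_ext n (F G : 'I_n -> R) :
  (forall i, F i ≡ G i) -> \sum_(i < n) F i ≡ \sum_(i < n) G i.
Proof.
move=> FG; apply: (big_ind2 (fun x y => x ≡ y)) => //; first by reflexivity.
by move=> x y x' y' xy x'y'; rewrite xy x'y'; reflexivity.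
Qed.

Lemma sum0 n : \sum_(i < n) (0 : R) ≡ 0.
Proof.
elim: n => [|n IH]; first by rewrite big_ord0; reflexivity.
by rewrite big_ord_recl IH; ring.
Qed.

Lemma sumD n (F G : 'I_n -> R) :
  \sum_(i < n) (F i + G i) ≡ \sum_(i < n) F i + \sum_(i < n) G i.
Proof.
elim: n F G => [|n IH] F G; first by rewrite !big_ord0; ring.
by rewrite !big_ord_recl IH; ring.
Qed.

Lemma mul_suml n c (F : 'I_n -> R) :
  c * \sum_(i < n) F i ≡ \sum_(i < n) (c * F i).
Proof.
elim: n F => [|n IH] F; first by rewrite !big_ord0; ring.
by rewrite !big_ord_recl -IH; ring.
Qed.

Lemma sum_ord1 (F : 'I_1 -> R) : \sum_(i < 1) F i ≡ F ord0.
Proof. by rewrite big_ord_recl big_ord0; ring. Qed.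

Lemma exchange_sum m n (F : 'I_m -> 'I_n -> R) :
  \sum_(i < m) \sum_(j < n) F i j ≡ \sum_(j < n) \sum_(i < m) F i j.
Proof.
elim: m F => [|m IH] F.
  rewrite big_ord0 -[X in X ≡ _](sum0 n); apply: sum_ext => j.
  by rewrite big_ord0; reflexivity.
rewrite big_ord_recl IH -sumD; apply: sum_ext => j.
by rewrite [X in _ ≡ X]big_ord_recl; reflexivity.
Qed.

#[global] Instance eqmat_equivalence m n : Equivalence (@eqmat R m n).
Proof.
split.
- by move=> A i j; reflexivity.
- by move=> A B AB i j; symmetry; apply: AB.
- by move=> A B C AB BC i j; rewrite (AB i j); apply: BC.
Qed.

#[global] Instance mulmat_proper m n p :
  Proper (@eqmat R m n ==> @eqmat R n p ==> @eqmat R m p) (@mulmat R m n p).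
Proof.
move=> A A' AA' B B' BB' i k; rewrite !mxE; apply: sum_ext => j.
by rewrite (AA' i j) (BB' j k); reflexivity.
Qed.

Lemma mulmatA m n p q (A : 'M[R]_(m, n)) (B : 'M_(n, p)) (C : 'M_(p, q)) :
  eqmat (mulmat (mulmat A B) C) (mulmat A (mulmat B C)).
Proof.
move=> i l; rewrite !mxE.
transitivity (\sum_(k < p) \sum_(j < n) (C k l * (A i j * B j k))).
  by apply: sum_ext => k; rewrite mxE -mul_suml; ring.
rewrite exchange_sum; apply: sum_ext => j.
by rewrite mxE mul_suml; apply: sum_ext => k; ring.
Qed.

Lemma mulmat0 m n p (A : 'M[R]_(m, n)) :
  eqmat (mulmat A (zeromat : 'M_(n, p))) zeromat.
Proof.
move=> i k; rewrite !mxE -[X in _ ≡ X](sum0 n); apply: sum_ext => j.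
by rewrite mxE; ring.
Qed.

Definition scalemat m n c (A : 'M[R]_(m, n)) : 'M[R]_(m, n) :=
  \matrix_(i, j) (c * A i j).

Lemma scalematE m n c (A : 'M[R]_(m, n)) i j : scalemat c A i j = c * A i j.
Proof. by rewrite mxE. Qed.

#[global] Instance scalemat_proper m n :
  Proper (req ==> @eqmat R m n ==> @eqmat R m n) (@scalemat m n).
Proof.
by move=> c c' cc' A A' AA' i j; rewrite !mxE cc' (AA' i j); reflexivity.
Qed.

Lemma scalematA m n a b (A : 'M[R]_(m, n)) :
  eqmat (scalemat a (scalemat b A)) (scalemat (a * b) A).
Proof. by move=> i j; rewrite !mxE; ring. Qed.

Lemma scalemat1 m n (A : 'M[R]_(m, n)) : eqmat (scalemat 1 A) A.
Proof. by move=> i j; rewrite !mxE; ring. Qed.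

Lemma scalemat0 m n c : eqmat (scalemat c (zeromat : 'M[R]_(m, n))) zeromat.
Proof. by move=> i j; rewrite !mxE; ring. Qed.

Lemma scalematl m n p c (A : 'M[R]_(m, n)) (B : 'M_(n, p)) :
  eqmat (mulmat (scalemat c A) B) (scalemat c (mulmat A B)).
Proof.
by move=> i k; rewrite !mxE mul_suml; apply: sum_ext => j; rewrite mxE; ring.
Qed.

Lemma scalematr m n p c (A : 'M[R]_(m, n)) (B : 'M_(n, p)) :
  eqmat (mulmat A (scalemat c B)) (scalemat c (mulmat A B)).
Proof.
by move=> i k; rewrite !mxE mul_suml; apply: sum_ext => j; rewrite mxE; ring.
Qed.

Lemma scalemat_cancel m n c v (A B : 'M[R]_(m, n)) :
  v * c ≡ 1 -> eqmat (scalemat c A) (scalemat c B) -> eqmat A B.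
Proof.
move=> vc AB; rewrite -(scalemat1 A) -(scalemat1 B) -vc -!scalematA.
by rewrite AB; reflexivity.
Qed.

Definition consmat m n (b : 'rV[R]_n) (A : 'M[R]_(m, n)) : 'M[R]_(m.+1, n) :=
  \matrix_(i, j) if unlift ord0 i is Some i' then A i' j else b ord0 j.

Lemma mulmat_cons p m n (L : 'M[R]_(p, m.+1)) (b : 'rV_n) (A : 'M_(m, n)) i k :
  mulmat L (consmat b A) i k ≡
  L i ord0 * b ord0 k + mulmat (\matrix_(i, j) L i (lift ord0 j)) A i k.
Proof.
rewrite !mxE big_ord_recl !mxE unlift_none; apply: radd_proper.
  by reflexivity.
by apply: sum_ext => j; rewrite !mxE liftK; reflexivity.
Qed.

(** Row [i] of [X A] involves only row [i] of [X], so the rows of [B] pose independent problems, and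
    there are finitely many of them to decide. *)
Lemma lifting_by_rows :
  (forall m n (A : 'M[R]_(m, n)) (b : 'rV_n),
    {x : 'rV_m | eqmat (mulmat x A) b}
    + {~ exists x : 'rV_m, eqmat (mulmat x A) b}) -> lifting_solver R.
Proof.
move=> solve m n q A B.
pose solvable i := if solve m n A (row i B) is inleft _ then true else false.
case: (boolP [forall i, solvable i]) => [/forallP all_solvable | nsolvable].
  left.
  have sol i : {x : 'rV_m | eqmat (mulmat x A) (row i B)}.
    by move: (all_solvable i); rewrite /solvable; case: (solve _ _ _ _).
  exists (\matrix_(i, j) sval (sol i) ord0 j)%R => i k.
  have := svalP (sol i) ord0 k; rewrite !mxE => <-.
  by apply: sum_ext => j; rewrite mxE; reflexivity.
right=> -[X XA]; case/negP: nsolvable; apply/forallP => i.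
rewrite /solvable; case: (solve _ _ _ _) => // -[]; exists (row i X) => z k.
rewrite !mxE -(XA i k) mxE; apply: sum_ext => j.
by rewrite mxE; reflexivity.
Qed.

End SetoidMatrices.

(** The product of the individual elements works for every index, since each [P i] is stable under
    multiples. [P] takes values in [Type] so that it can carry numerators as data. *)
Lemma common_multiple (R : comRing) (S : multClosed R) (I : finType)
    (P : I -> R -> Type) :
  (forall i r s, P i s -> P i (r * s)) ->
  (forall i r s, r ≡ s -> P i r -> P i s) ->
  (forall i, {s & S s & P i s}) ->
  {s & S s & forall i, P i s}.
Proof.
move=> Pmul Pext ex.
suff [s Ss Ps] : {s & S s & forall i, i \in enum I -> P i s}.
  by exists s => // i; apply: Ps; rewrite mem_enum.
elim: (enum I) => [|i e [s Ss Ps]]; first by exists 1 => //; apply: mc_one.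
have [t St Pt] := ex i.
exists (s * t) => [|j]; first exact: mc_mul.
have st : t * s ≡ s * t by apply: (Rmul_comm (rth R)).
case: (eqVneq j i) => [-> _ | ji]; first exact: Pmul.
by rewrite inE (negbTE ji) /= => /Ps /(Pmul j t s); apply: Pext.
Qed.

(** The interface through which the localization is used. Inverses and numerators are data because
    solutions are built from them; [loc_ker] is only propositional, as fraction equality hides its
    multiplier in [Prop]. *)
Record is_localization (R : comRing) (S : multClosed R) (Q : comRing)
    (h : R -> Q) : Type := IsLocalization {
  loc_ext : Proper (req ==> req) h;
  loc_add : forall x y, h (x + y) ≡ h x + h y;
  loc_mul : forall x y, h (x * y) ≡ h x * h y;
  loc_zero : h 0 ≡ 0;
  loc_inv : forall s, S s -> {v : Q | v * h s ≡ 1};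
  loc_frac : forall q : Q, {s & S s & {x : R | h s * q ≡ h x}};
  loc_ker : forall x, h x ≡ 0 -> exists2 u, S u & u * x ≡ 0
}.

(** * Transfer of matrices between the base ring and its localization *)

Section Computable.
Variables (R : comRing) (S : multClosed R) (Q : comRing) (h : R -> Q).
Hypothesis hP : is_localization S h.

Add Ring base_ring : (rth R) (setoid (req_equiv R) (req_ext R)).
Add Ring loc_ring : (rth Q) (setoid (req_equiv Q) (req_ext Q)).

#[local] Instance h_proper : Proper (req ==> req) h := loc_ext hP.

Lemma loc_opp x : h (- x) ≡ - h x.
Proof.
transitivity (h (- x + x) + - h x); first by rewrite (loc_add hP); ring.
by rewrite (Radd_comm (rth R)) (Ropp_def (rth R)) (loc_zero hP); ring.
Qed.

Lemma loc_sum n (F : 'I_n -> R) :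
  h (\sum_(i < n) F i) ≡ \sum_(i < n) h (F i).
Proof.
elim: n F => [|n IH] F; first by rewrite !big_ord0; apply: (loc_zero hP).
by rewrite !big_ord_recl (loc_add hP) IH; reflexivity.
Qed.

Lemma map_mulmat m n p (A : 'M[R]_(m, n)) (B : 'M_(n, p)) :
  eqmat (map_mx h (mulmat A B)) (mulmat (map_mx h A) (map_mx h B)).
Proof.
move=> i k; rewrite !mxE loc_sum.
by apply: sum_ext => j; rewrite !mxE; apply: (loc_mul hP).
Qed.

Lemma map_scalemat m n c (A : 'M[R]_(m, n)) :
  eqmat (map_mx h (scalemat c A)) (scalemat (h c) (map_mx h A)).
Proof. by move=> i j; rewrite !mxE; apply: (loc_mul hP). Qed.

#[local] Instance map_mx_proper m n :
  Proper (@eqmat R m n ==> @eqmat Q m n) (map_mx h).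
Proof.
by move=> A B AB i j; rewrite !mxE; apply: (loc_ext hP); apply: AB.
Qed.

Lemma map_zeromat m n : eqmat (map_mx h (zeromat : 'M_(m, n))) zeromat.
Proof. by move=> i j; rewrite !mxE; apply: (loc_zero hP). Qed.

Lemma clear_denominators m n (A : 'M[Q]_(m, n)) :
  {s & S s & {A' : 'M[R]_(m, n) | eqmat (scalemat (h s) A) (map_mx h A')}}.
Proof.
pose P (ij : 'I_m * 'I_n) s := {x : R | h s * A ij.1 ij.2 ≡ h x}.
have [||ij|s Ss Ps] := @common_multiple R S ('I_m * 'I_n)%type P.
- move=> ij r s [x xP]; exists (r * x); rewrite !(loc_mul hP) -xP; ring.
- by move=> ij r s rs [x xP]; exists x; rewrite -rs.
- exact: (loc_frac hP).
exists s => //; exists (\matrix_(i, j) sval (Ps (i, j)))%R => i j.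
by rewrite !mxE; apply: (svalP (Ps (i, j))).
Qed.

(** * Annihilators, syzygies and liftings from the two given algorithms *)

Hypotheses (cohR : coherent R) (locS : localization_solver S).

Lemma find_annihilator x : h x ≡ 0 -> {u & S u & u * x ≡ 0}.
Proof.
move=> hx0.
(* The entries of the column [L] generate the annihilator of [x]. *)
have [o L L0 Lfactor] := cohR (const_mx x : 'M_(1, 1)).
case: (locS (fun i => L i ord0)) => [[a /= [_ Sa]] | noann].
  exists (\sum_(i < o) (a i * L i ord0)) => //.
  have aLx : eqmat (mulmat (mulmat (\row_i a i) L) (const_mx x : 'M_(1, 1)))
               zeromat by rewrite mulmatA L0 mulmat0; reflexivity.
  have := aLx ord0 ord0; rewrite !mxE sum_ord1 !mxE => aLx0.
  rewrite -[X in _ ≡ X]aLx0; apply: rmul_proper; last by reflexivity.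
  by apply: sum_ext => i; rewrite mxE; reflexivity.
(* With [False] as the goal, the propositional multiplier from [loc_ker] may be opened; it refutes a
   negative answer of the solver. *)
exfalso; apply: noann.
have [u Su ux0] := loc_ker hP hx0.
have [|U UL] := Lfactor 1%N (const_mx u).
  by move=> i j; rewrite !mxE sum_ord1 !mxE.
exists u; split=> //; exists (U ord0).
by have := UL ord0 ord0; rewrite !mxE => <-; reflexivity.
Qed.

Lemma clear_kernel m n (A : 'M[R]_(m, n)) :
  eqmat (map_mx h A) zeromat ->
  {u & S u & eqmat (scalemat u A) zeromat}.
Proof.
move=> hA0.
pose P (ij : 'I_m * 'I_n) u := u * A ij.1 ij.2 ≡ 0.
have [|||u Su Pu] := @common_multiple R S ('I_m * 'I_n)%type P.
- by move=> ij r s Ps; rewrite /P -(Rmul_assoc (rth R)) Ps; ring.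
- by move=> ij r s rs; rewrite /P rs.
- by move=> ij; apply: find_annihilator; have := hA0 ij.1 ij.2; rewrite !mxE.
by exists u => // i j; rewrite !mxE; apply: (Pu (i, j)).
Qed.

Lemma localization_coherent : coherent Q.
Proof.
move=> m n A.
have [d Sd [A' dA]] := clear_denominators A.
have [o L L0 Lfactor] := cohR A'.
have [v vd] := loc_inv hP Sd.
apply: (@Syzygies _ _ _ _ o (map_mx h L)).
  apply: (scalemat_cancel vd).
  rewrite -scalematr dA -map_mulmat L0 map_zeromat scalemat0; reflexivity.
move=> p T TA0.
have [t St [T' tT]] := clear_denominators T.
(* [T' A'] vanishes only after mapping to [Q]; the factor [u] turns [T'] into a genuine syzygy over
   [R]. *)
have [|u Su uTA] := @clear_kernel _ _ (mulmat T' A').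
  rewrite map_mulmat -tT -dA scalematl scalematr TA0 !scalemat0; reflexivity.
have [|U UL] := Lfactor p (scalemat u T'); first by rewrite scalematl.
(* Dividing by [h (u * t)] undoes both the factor [u] and the clearing of denominators in [T]. *)
have [w wut] := loc_inv hP (mc_mul Su St).
exists (scalemat w (map_mx h U)).
rewrite scalematl -map_mulmat UL map_scalemat -tT !scalematA.
rewrite -[X in eqmat _ X]scalemat1 -wut (loc_mul hP).
by apply: scalemat_proper; [ring | reflexivity].
Qed.

Lemma localization_lifting : lifting_solver Q.
Proof.
apply: lifting_by_rows => m n A b.
have [d Sd [A' dA]] := clear_denominators A.
have [e Se [b' eb]] := clear_denominators b.
have [o L L0 Lfactor] := cohR (consmat b' A').
case: (locS (fun i => L i ord0)) => [[a /= [_ Ss]] | nosol].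
  set s := \sum_(i < o) _ in Ss; left.
  (* The combination of the rows of [L] with coefficients [a] is the syzygy [(s, N)], so
     [s b' + N A' = 0] and [y = -N] solves [y A' = s b']. *)
  pose N : 'rV[R]_m := (\matrix_(i, j) mulmat (\row_i a i) L i (lift ord0 j))%R.
  pose y := scalemat (- (1)) N.
  have yA : eqmat (mulmat y A') (scalemat s b').
    move=> i k; rewrite (ord1 i : i = ord0) {i}.
    have aL0 : eqmat (mulmat (mulmat (\row_i a i) L) (consmat b' A')) zeromat.
      by rewrite mulmatA L0 mulmat0; reflexivity.
    have aLs : mulmat (\row_i a i) L ord0 ord0 ≡ s.
      by rewrite mxE; apply: sum_ext => i; rewrite mxE; reflexivity.
    have := aL0 ord0 k.
    rewrite mulmat_cons aLs -/N [X in _ ≡ X]mxE (scalematl _ _ _ ord0 k).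
    rewrite !scalematE => E.
    transitivity (s * b' ord0 k + - (s * b' ord0 k + mulmat N A' ord0 k)).
      by ring.
    by rewrite E; ring.
  (* Since [h d A = h A'] and [h b' = h e b], the row [h d h(y)] is sent by [A] to [h s h e b]; [v]
     removes this factor. *)
  have [v ves] := loc_inv hP (mc_mul Se Ss).
  exists (scalemat (v * h d) (map_mx h y)).
  rewrite scalematl -scalematA -scalematr dA -map_mulmat yA map_scalemat -eb.
  rewrite !scalematA -[X in eqmat _ X]scalemat1 -ves (loc_mul hP).
  by apply: scalemat_proper; [ring | reflexivity].
right=> -[x xA]; apply: nosol.
have [t St [x' tx]] := clear_denominators x.
(* With [h t x = h x'], the equation [x A = b] multiplied by [h t h d h e] reads
   [h (t d b') = h (e x' A')]. Hence [(t d, -e x')] is a syzygy after mapping to [Q]. *)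
pose w : 'rV[R]_m.+1 :=
  (\row_j if unlift ord0 j is Some j' then (- e * x' ord0 j')%SR
    else (t * d)%SR)%R.
have wM k : mulmat w (consmat b' A') ord0 k ≡
    t * d * b' ord0 k + mulmat (scalemat (- e) x') A' ord0 k.
  rewrite mulmat_cons mxE unlift_none; apply: radd_proper; first by reflexivity.
  apply: mulmat_proper; last by reflexivity.
  by move=> i j; rewrite !mxE liftK (ord1 i : i = ord0); reflexivity.
have [|u Su uw0] := @clear_kernel _ _ (mulmat w (consmat b' A')).
  have ex'A' : eqmat (map_mx h (mulmat (scalemat (- e) x') A'))
                 (scalemat (- h e * h t * h d) b).
    rewrite map_mulmat map_scalemat loc_opp -tx -dA !scalematl scalematr xA.
    by rewrite !scalematA; reflexivity.
  move=> i k; rewrite (ord1 i : i = ord0) {i} [X in X ≡ _]mxE wM (loc_add hP).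
  have := ex'A' ord0 k; rewrite [X in X ≡ _]mxE => ->.
  have := eb ord0 k; rewrite [X in _ ≡ X]mxE !(loc_mul hP) => <-.
  by rewrite !scalematE mxE; ring.
have [|U UL] := Lfactor 1%N (scalemat u w); first by rewrite scalematl.
(* The first entry of the syzygy [u w] lies in [S], and [U] writes it as a combination of the first
   column of [L]. *)
exists (u * (t * d)); split; last by do !apply: mc_mul.
exists (U ord0); have := UL ord0 ord0.
by rewrite scalematE !mxE unlift_none => <-; reflexivity.
Qed.

End Computable.

(** * The fractions satisfy the interface *)

Section Fractions.
Variables (R : comRing) (S : multClosed R).
Add Ring frac_base_ring : (rth R) (setoid (req_equiv R) (req_ext R)).

Lemma localization_is_localization :
  is_localization S (fun x => Frac x (mc_one S) : localization S).
Proof.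
split.
- by move=> x y xy; apply: frac_eq_of => /=; rewrite xy; reflexivity.
- by move=> x y; apply: frac_eq_of => /=; ring.
- by move=> x y; apply: frac_eq_of => /=; ring.
- by apply: frac_eq_of => /=; ring.
- by move=> s Ss; exists (Frac 1 Ss); apply: frac_eq_of => /=; ring.
- move=> [x s Ss]; exists s => //; exists x.
  by apply: frac_eq_of => /=; ring.
move=> x [u Su /= ux]; exists u => //.
transitivity (u * (x * 1)); first by ring.
by rewrite ux; ring.
Qed.

End Fractions.

Theorem theorem3p9 (R : comRing) (S : multClosed R)
  (R_coherent : coherent R) (S_solver : localization_solver S) :
  computable (localization S).
Proof.
have locP := localization_is_localization S.
split; first exact: (localization_coherent locP).
exact: (localization_lifting locP).
Qed.
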